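(* Let $X$ be a set, $I$ a nonempty finite set, $\mathcal{F}=(f_i)_{i\in I}$, $f_i:X\to X$, a family of functions having attractor $A$, and $\mu=(z_n)_{n\in\mathbb{N}}$ a sequence of real numbers with $0<z_{n+1}\le z_n$ for every $n\in\mathbb{N}$. The function $d^\mu:X\times X\to[0,\infty)$ associated to $\mu$ and $\mathcal{F}$ satisfies: a) $d^\mu(x,x)=0$ for every $x\in X$; b) $d^\mu(x,y)=d^\mu(y,x)$ for every $x,y\in X$; c) $d^\mu(x,y)\le d^\mu(x,z)+d^\mu(z,y)$ for every $x,y,z\in X$; d) $d^\mu(x,y)>0$ for every $x\in X\smallsetminus A$ and every $y\in X\smallsetminus\{x\}$; e) $d^\mu(f_i(x),f_i(y))\le d^\mu(x,y)$ for every $x,y\in X$ and every $i\in I$; f) $d^\mu(x,y)\le z_0$ for every $x,y\in X$; g) if the sequence $\mu$ is constant, then $d^\mu$ is a metric.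
   Context: $\mathbb{N}=\{0,1,2,\dots\}$ and $\mathbb{N}^*=\{1,2,\dots\}$. $\Lambda(I)=I^{\mathbb{N}^*}$ is the set of infinite words with letters in $I$; $\Lambda^*(I)$ is the set of all finite words with letters in $I$, including the empty word $\lambda$; $|\alpha|$ is the length of a finite word $\alpha$. For $\alpha=\alpha_1\alpha_2\dots\in\Lambda(I)$, $[\alpha]_n=\alpha_1\dots\alpha_n$ if $n\ge 1$ and $[\alpha]_0=\lambda$. Put $f_\lambda=\mathrm{Id}_X$, $f_{\alpha_1\dots\alpha_m}=f_{\alpha_1}\circ\dots\circ f_{\alpha_m}$, and $X_\alpha=f_\alpha(X)$ for $\alpha\in\Lambda^*(I)$. Family having attractor: $(f_i)_{i\in I}$ ($I$ finite) has attractor if: (a) for every $\alpha\in\Lambda(I)$ the set $\bigcap_{n\in\mathbb{N}}X_{[\alpha]_n}$ has a unique element, denoted $a_\alpha$; (b) if $a_\alpha\ne a_\beta$, then there exists $n_0\in\mathbb{N}$ with $X_{[\alpha]_{n_0}}\cap X_{[\beta]_{n_0}}=\emptyset$. The attractor is $A=\{a_\alpha\mid\alpha\in\Lambda(I)\}$. For $\alpha\in\Lambda^*(I)$: $Y_\alpha=\{a_\beta\mid \beta\in\Lambda(I),\ X_\alpha\cap X_{[\beta]_n}\ne\emptyset\text{ for every }n\in\mathbb{N}\}$ and $\widetilde{X_\alpha}=X_\alpha\cup Y_\alpha$. The function $d^\mu$: $d^\mu(x,y)=0$ if $x=y$, and $d^\mu(x,y)=\inf M_{x,y}$ if $x\ne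 y$, where $M_{x,y}$ is the set of all sums $\sum_{i=0}^n z_{|\alpha_i|}$ with $n\in\mathbb{N}$ and $\alpha_0,\dots,\alpha_n\in\Lambda^*(I)$ such that $x\in\widetilde{X_{\alpha_0}}$, $y\in\widetilde{X_{\alpha_n}}$ and $\widetilde{X_{\alpha_i}}\cap\widetilde{X_{\alpha_{i+1}}}\ne\emptyset$ for every $i\in\{0,1,\dots,n-1\}$. *)

(* Defs.v *)
From HB Require Import structures.
From mathcomp Require Import all_boot all_order all_algebra.
From mathcomp Require Import all_classical all_reals.

Set Implicit Arguments.
Unset Strict Implicit.
Unset Printing Implicit Defensive.

Import Order.TTheory GRing.Theory Num.Theory.

Local Open Scope classical_set_scope.
Local Open Scope ring_scope.

(* Finite words are [seq I].  An infinite word is [w : nat -> I], indexed from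
   0: its n-th letter (n >= 1) is [w n.-1], so that [mkseq w n] is its prefix
   of length n. *)

Section Attractor.
Variables (X : Type) (I : finType) (f : I -> X -> X).

Definition word_fun (u : seq I) : X -> X :=
  foldr (fun i g => f i \o g) idfun u.

Definition word_set (u : seq I) : set X := word_fun u @` setT.

(* [a] is the point a_w of the infinite word [w]; a relation, since a_w is
   only defined when the intersection is a singleton. *)
Definition is_word_point (w : nat -> I) (a : X) : Prop :=
  \bigcap_(n in [set: nat]) word_set (mkseq w n) = [set a].

Definition has_attractor : Prop :=
  (forall w : nat -> I, exists a : X, is_word_point w a) /\
  (forall (v w : nat -> I) (a b : X),
     is_word_point v a -> is_word_point w b -> a <> b ->
     exists n0 : nat,
       word_set (mkseq v n0) `&` word_set (mkseq w n0) = set0).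

Definition attractor : set X :=
  [set a | exists w : nat -> I, is_word_point w a].

Definition word_boundary (u : seq I) : set X :=
  [set a | exists w : nat -> I, is_word_point w a /\
     forall n : nat, word_set u `&` word_set (mkseq w n) !=set0].

Definition ext_word_set (u : seq I) : set X := word_set u `|` word_boundary u.

(* A chain of n + 1 words is given by a sequence of words of which only the
   terms of index at most n matter. *)
Definition is_chain (x y : X) (n : nat) (u : nat -> seq I) : Prop :=
  [/\ ext_word_set (u 0%N) x,
      ext_word_set (u n) y &
      forall i : nat, (i < n)%N ->
        ext_word_set (u i) `&` ext_word_set (u i.+1) !=set0].

Variables (R : realType) (z : nat -> R).

Definition chain_sums (x y : X) : set R :=
  [set s | exists (n : nat) (u : nat -> seq I),
     is_chain x y n u /\ s = \sum_(0 <= i < n.+1) z (size (u i))].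

Definition dmu (x y : X) : R :=
  if `[< x = y >] then 0 else inf (chain_sums x y).

End Attractor.

Definition is_metric (R : realType) (X : Type) (d : X -> X -> R) : Prop :=
  [/\ forall x y : X, 0 <= d x y,
      forall x y : X, d x y = 0 <-> x = y,
      forall x y : X, d x y = d y x &
      forall x y t : X, d x y <= d x t + d t y].

(* Main.v *)
Require Import Defs.
From HB Require Import structures.
From mathcomp Require Import all_boot all_order all_algebra.
From mathcomp Require Import all_classical all_reals.

(** The value [dmu f z x y] is the least cost of joining [x] to [y] by a chain
    of extended pieces, a piece of level [n] costing [z n].  Reversing a chain
    gives symmetry, gluing two chains at a common point gives the triangle
    inequality, and the one-word chain made of the empty word, whose piece is
    the whole space, gives the bound [z 0].  The maps [f i] are nonexpansive
    because [f i] sends the extended piece of [u] into that of [i :: u]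
    ([ext_word_set_cons]): a chain is carried to a chain of deeper, hence
    cheaper, words.

    The only delicate point is positivity off the attractor.  A chain starting
    at [x] costs at least [z (size u)], where [u] is its first word, so it is
    enough to bound the levels of the extended pieces containing [x].  If [x]
    is not in the attractor, such a piece contains [x] in its genuine part
    [word_set u]; the words [u] with this property form a prefix-closed tree
    over a finite alphabet, and by Koenig's lemma ([infinite_branch]) an
    infinite tree would have an infinite branch [w].  Then [x] would lie in
    every [word_set (mkseq w n)], so it would be the point of [w], which
    belongs to the attractor ([ext_word_set_size_bounded]).

    When the sequence [z] is constant, every chain costs at least one term, so
    distinct points are at distance at least this constant. *)

Set Implicit Arguments.
Unset Strict Implicit.
Unset Printing Implicit Defensive.

Import Order.TTheory GRing.Theory Num.Theory.

Local Open Scope classical_set_scope.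
Local Open Scope ring_scope.

(** * Infinite branches of finitely branching trees *)

(** Koenig's lemma: keep choosing a letter below which the tree has words of
    unbounded length.  One exists because there are finitely many letters, so
    bounds for all of them would have a common maximum. *)
Lemma infinite_branch (I : finType) (P : seq I -> Prop) :
  (forall u v, P (u ++ v) -> P u) ->
  (forall N, exists u, (N <= size u)%N /\ P u) ->
  exists w : nat -> I, forall n, P (mkseq w n).
Proof.
move=> Pprefix Punbounded.
pose good u := forall N, exists v, (N <= size v)%N /\ P (u ++ v).
have good_step u : good u -> exists i, good (rcons u i).
  move=> gu; apply: contrapT => /forallNP nogood.
  have /choice[N HN] i : exists N, forall v, (N <= size v)%N ->
      ~ P (rcons u i ++ v).
    have /existsNP[N /forallNP HN] := nogood i.
    by exists N => v szv Pv; apply: (HN v).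
  (* the successor leaves room for the letter consumed by [rcons] *)
  have [[|i v] [szv Pv]] := gu (\max_i N i).+1; first by [].
  apply: (HN i v); last by rewrite cat_rcons.
  by apply: leq_trans (leq_bigmax i) _.
have [[|i0 u0] [sz0 _]] := Punbounded 1%N; first by [].
(* [i0] is a default letter, used only below words that are not good *)
have /choice[h hP] u : exists i, good u -> good (rcons u i).
  have [/good_step[i gi]|ngu] := pselect (good u); first by exists i.
  by exists i0.
pose s := fix s n := if n is m.+1 then rcons (s m) (h (s m)) else [::].
have mkseq_s n : mkseq (h \o s) n = s n.
  by elim: n => //= n IHn; rewrite mkseqS IHn.
have good_s n : good (s n).
  by elim: n => [|n IHn] /=; [exact: Punbounded | exact: hP].
exists (h \o s) => n; rewrite mkseq_s.
by have [v [_ /Pprefix]] := good_s n 0%N.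
Qed.

(** * Extended pieces *)

Section ExtendedPieces.
Variables (X : Type) (I : finType) (f : I -> X -> X).

Lemma word_set_cat (u v : seq I) (x : X) :
  word_set f (u ++ v) x -> word_set f u x.
Proof.
have word_fun_cat y : word_fun f (u ++ v) y = word_fun f u (word_fun f v y).
  by elim: u => //= i u ->.
by case=> y _ <-; exists (word_fun f v y); rewrite ?word_fun_cat.
Qed.

Lemma word_set_cons (i : I) (u : seq I) (x : X) :
  word_set f u x -> word_set f (i :: u) (f i x).
Proof. by case=> y _ <-; exists y. Qed.

Lemma ext_word_set_nil (x : X) : ext_word_set f [::] x.
Proof. by left; exists x. Qed.

Lemma mkseq_word_cons (i : I) (w : nat -> I) (n : nat) :
  mkseq (fun k => if k is m.+1 then w m else i) n.+1 = i :: mkseq w n.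
Proof. by rewrite /mkseq /= -[1%N]/(1 + 0)%N iotaDl -map_comp. Qed.

Hypothesis f_attr : has_attractor f.

(** The nested pieces along [w] meet in a single point, so membership in all of
    them identifies that point. *)
Lemma mem_prefixes_word_point (w : nat -> I) (a : X) :
  (forall n, word_set f (mkseq w n) a) -> is_word_point f w a.
Proof.
move=> aw; have [b bw] := f_attr.1 w.
suff -> : a = b by [].
by have : (\bigcap_(n in [set: nat]) word_set f (mkseq w n)) a by [];
  rewrite bw.
Qed.

Lemma is_word_point_cons (i : I) (w : nat -> I) (a : X) :
  is_word_point f w a ->
  is_word_point f (fun k => if k is m.+1 then w m else i) (f i a).
Proof.
move=> aw; apply: mem_prefixes_word_point => -[|n]; first by exists (f i a).
rewrite mkseq_word_cons; apply: word_set_cons.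
have : [set a] a by [].
by rewrite -aw; apply.
Qed.

(** Prefixing by [i] turns both an address of a boundary point and the
    intersections that witness it into those of its image under [f i]. *)
Lemma ext_word_set_cons (i : I) (u : seq I) (x : X) :
  ext_word_set f u x -> ext_word_set f (i :: u) (f i x).
Proof.
case=> [ux|[w [xw meet]]]; first by left; exact: word_set_cons.
right; eexists; split; first exact: is_word_point_cons xw.
case=> [|n].
  have [y [uy _]] := meet 0%N.
  by exists (f i y); split; [exact: word_set_cons | exists (f i y)].
have [y [uy wy]] := meet n.
by exists (f i y); split; rewrite ?mkseq_word_cons; exact: word_set_cons.
Qed.

(** A point in pieces of arbitrarily deep level has an infinite address by
    [infinite_branch], hence is in the attractor; boundary points are in the
    attractor from the start. *)
Lemma ext_word_set_size_bounded (x : X) : ~ attractor f x ->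
  exists N, forall u, ext_word_set f u x -> (size u <= N)%N.
Proof.
move=> xA; apply: contrapT => /forallNP unbounded.
have [u v|N|w xw] := @infinite_branch I (fun u => word_set f u x).
- exact: word_set_cat.
- have /existsNP[u /not_implyP[ux /negP]] := unbounded N.
  rewrite -ltnNge => /ltnW Nu; exists u; split=> //.
  by case: ux => // -[w [xw _]]; case: xA; exists w.
- by apply: xA; exists w; exact: mem_prefixes_word_point.
Qed.

End ExtendedPieces.

(** * Chains and their costs *)

Section Chains.
Variables (X : Type) (I : finType) (f : I -> X -> X).
Variables (R : realType) (z : nat -> R).

Lemma chain_sums_nil (x y : X) : chain_sums f z x y (z 0%N).
Proof.
exists 0%N, (fun=> [::]); split; last by rewrite big_nat1.
by split=> //; exact: ext_word_set_nil.
Qed.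

Lemma chain_sums_rev (x y : X) (s : R) :
  chain_sums f z x y s -> chain_sums f z y x s.
Proof.
move=> [n [u [[ux uy meet] ->]]].
exists n, (fun i => u (n - i)%N); split; last first.
  by rewrite big_nat_rev /=; apply: eq_big_nat => i _; rewrite add0n subSS.
split; rewrite ?subn0 ?subnn // => i lt_in.
rewrite setIC -[in X in _ `&` X](subnSK lt_in).
by apply: meet; rewrite subnSK // leq_subr.
Qed.

(** The last piece of the first chain and the first piece of the second both
    contain [t], so the concatenated sequence of words is again a chain. *)
Lemma chain_sums_cat (x t y : X) (s s' : R) :
  chain_sums f z x t s -> chain_sums f z t y s' ->
  chain_sums f z x y (s + s').
Proof.
move=> [n [u [[ux ut meetu] ->]]] [m [v [[vt vy meetv] ->]]].
exists (n.+1 + m)%N, (fun i => if (i <= n)%N then u i else v (i - n.+1)%N).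
split; last first.
  rewrite -addnS [RHS](big_cat_nat (n := n.+1)) ?leq_addr //=.
  congr (_ + _); first by apply: eq_big_nat => i /andP[_]; rewrite ltnS => ->.
  rewrite -[X in \sum_(X <= _ < n.+1 + _) _]add0n big_addn addKn.
  by apply: eq_big_nat => i _; rewrite leqNgt addnS ltnS leq_addl /= -addnS addnK.
split; first by [].
  by rewrite leqNgt addSn ltnS leq_addr /= -addSn addKn.
move=> i lt_i; case: (ltngtP i n) => [lt_in|lt_ni|->].
- exact: meetu.
- by rewrite subSn //; apply: meetv; rewrite -subSn // leq_subLR.
- by rewrite subnn; exists t.
Qed.

Hypothesis z_pos_decr : forall n, 0 < z n.+1 <= z n.

Lemma weight_gt0 (n : nat) : 0 < z n.
Proof. by have /andP[zS_gt0] := z_pos_decr n; exact: lt_le_trans. Qed.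

Lemma weight_le (m n : nat) : (m <= n)%N -> z n <= z m.
Proof.
move=> /subnK <-; elim: (n - m)%N => //= k; apply: le_trans.
by have /andP[] := z_pos_decr (k + m).
Qed.

Lemma chain_sums_ge_first (x y : X) (s : R) : chain_sums f z x y s ->
  exists2 u, ext_word_set f u x & z (size u) <= s.
Proof.
move=> [n [u [[ux _ _] ->]]]; exists (u 0%N) => //.
rewrite big_nat_recl // lerDl; apply: sumr_ge0 => i _.
exact/ltW/weight_gt0.
Qed.

Lemma chain_sums_ge0 (x y : X) (s : R) : chain_sums f z x y s -> 0 <= s.
Proof.
by move=> /chain_sums_ge_first[u _]; apply: le_trans; exact/ltW/weight_gt0.
Qed.

Lemma chain_sums_map (i : I) (x y : X) (s : R) : has_attractor f ->
  chain_sums f z x y s ->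
  exists2 s', chain_sums f z (f i x) (f i y) s' & s' <= s.
Proof.
move=> f_attr [n [u [[ux uy meet] ->]]].
exists (\sum_(0 <= k < n.+1) z (size (i :: u k))); last first.
  by apply: ler_sum => k _; exact: weight_le.
exists n, (fun k => i :: u k); split=> //.
split; [exact: ext_word_set_cons..|move=> k /meet[t [ukt uSkt]]].
by exists (f i t); split; exact: ext_word_set_cons.
Qed.

(** * The infimum over chains *)

Lemma dmu_le_sum (x y : X) (s : R) : chain_sums f z x y s -> dmu f z x y <= s.
Proof.
move=> xys; rewrite /dmu; case: ifP => _; first exact: chain_sums_ge0 xys.
by apply: ge_inf => //; exists 0 => ?; exact: chain_sums_ge0.
Qed.

Lemma le_dmu (x y : X) (m : R) : x <> y ->
  (forall s, chain_sums f z x y s -> m <= s) -> m <= dmu f z x y.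
Proof.
move=> xy lb; rewrite /dmu asboolF //.
by apply: lb_le_inf => //; exists (z 0%N); exact: chain_sums_nil.
Qed.

Lemma dmu_xx (x : X) : dmu f z x x = 0.
Proof. by rewrite /dmu asboolT. Qed.

Lemma dmu_ge0 (x y : X) : 0 <= dmu f z x y.
Proof.
have [->|xy] := pselect (x = y); first by rewrite dmu_xx.
by apply: le_dmu => // s; exact: chain_sums_ge0.
Qed.

Lemma dmu_sym (x y : X) : dmu f z x y = dmu f z y x.
Proof.
have le_sym a b : dmu f z a b <= dmu f z b a.
  have [->|ab] := pselect (b = a); first by rewrite dmu_xx.
  by apply: le_dmu => // s /chain_sums_rev/dmu_le_sum.
by apply: le_anti; rewrite !le_sym.
Qed.

Lemma dmu_triangle (x y t : X) : dmu f z x y <= dmu f z x t + dmu f z t y.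
Proof.
have [->|xt] := pselect (x = t); first by rewrite dmu_xx add0r.
have [->|ty] := pselect (t = y); first by rewrite dmu_xx addr0.
rewrite -lerBlDr; apply: le_dmu => // s xts.
rewrite lerBlDr -lerBlDl; apply: le_dmu => // s' tys'.
by rewrite lerBlDl; apply: dmu_le_sum; exact: chain_sums_cat tys'.
Qed.

Lemma dmu_gt0 (x y : X) : has_attractor f -> ~ attractor f x -> y <> x ->
  0 < dmu f z x y.
Proof.
move=> f_attr /(ext_word_set_size_bounded f_attr)[N bound] /nesym xy.
apply: lt_le_trans (weight_gt0 N) _; apply: le_dmu => // s.
move=> /chain_sums_ge_first[u /bound uN]; apply: le_trans.
exact: weight_le.
Qed.

Lemma dmu_nonexpansive (i : I) (x y : X) : has_attractor f ->
  dmu f z (f i x) (f i y) <= dmu f z x y.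
Proof.
move=> f_attr; have [->|xy] := pselect (x = y); first by rewrite !dmu_xx.
apply: le_dmu => // s /(chain_sums_map i f_attr)[s' /dmu_le_sum].
exact: le_trans.
Qed.

Lemma dmu_metric (c : R) : (forall n, z n = c) -> is_metric (dmu f z).
Proof.
move=> zc; split; [exact: dmu_ge0| |exact: dmu_sym|exact: dmu_triangle].
move=> x y; split=> [dxy0|->]; last exact: dmu_xx.
apply: contrapT => xy.
suff : c <= dmu f z x y by rewrite dxy0 leNgt -(zc 0%N) weight_gt0.
by apply: le_dmu => // s /chain_sums_ge_first[u _]; rewrite zc.
Qed.

End Chains.

Theorem proposition3p8 (R : realType) (X : Type) (I : finType)
    (I_nonempty : (0 < #|I|)%N)
    (f : I -> X -> X) (z : nat -> R)
    (f_attr : has_attractor f)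
    (z_pos_decr : forall n : nat, 0 < z n.+1 <= z n) :
  (forall x y : X, 0 <= dmu f z x y) /\
  (forall x : X, dmu f z x x = 0) /\
  (forall x y : X, dmu f z x y = dmu f z y x) /\
  (forall x y t : X, dmu f z x y <= dmu f z x t + dmu f z t y) /\
  (forall x y : X, ~ attractor f x -> y <> x -> 0 < dmu f z x y) /\
  (forall (x y : X) (i : I), dmu f z (f i x) (f i y) <= dmu f z x y) /\
  (forall x y : X, dmu f z x y <= z 0%N) /\
  ((exists c : R, forall n : nat, z n = c) -> is_metric (dmu f z)).
Proof.
split; first exact: dmu_ge0.
split; first exact: dmu_xx.
split; first exact: dmu_sym.
split; first exact: dmu_triangle.
split; first by move=> x y; exact: dmu_gt0.
split; first by move=> x y i; exact: dmu_nonexpansive.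
split; first by move=> x y; apply: dmu_le_sum => //; exact: chain_sums_nil.
by case=> c; exact: dmu_metric.
Qed.
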